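(* Let $(P,\le)$ be a finite poset with $|P|=n$, and let $m$ denote the number of two-element antichains in $P$, i.e. the set $\{(x,y)\in P\times P\mid x\parallel y\}$ has cardinality $2m$. Assume that $P$ is not a chain, so that $m>0$. Then the set of all probability functions on $P$ forms a convex polytope, which can be realised inside $\mathbb{R}^{n^2}$, or inside $\mathbb{R}^{n^2-n}$, but also inside $\mathbb{R}^{2m}$.
   Context: For $x,y\in P$, $x\parallel y$ means that neither $x\le y$ nor $y\le x$. A probability function on $P$ is a function $\pi:P\times P\to[0,1]$ such that for all $x,y,z\in P$: (1) $\pi(x,x)=1$; (2) $x\le y$ implies $\pi(x,y)=1$; (3) $x\ne y$ implies $\pi(x,y)+\pi(y,x)=1$; (4) $y<z$ implies $\pi(x,y)\le\pi(x,z)$. The realisations are the following. Inside $\mathbb{R}^{n^2}=\mathbb{R}^{P\times P}$: a probability function is identified with the vector (or $n\times n$ matrix) of all its values. Inside $\mathbb{R}^{n^2-n}$: it is identified with the vector of its values at pairs $(x,y)$ with $x\neq y$ (forgetting the diagonal coordinates). Inside $\mathbb{R}^{2m}$: it is identified with the vector of its values at pairs $(x,y)$ with $x\parallel y$ (forgetting also the coordinates of comparable pairs). ''Realised'' means that the identification is injective on the set of probability functions and its image is a convex polytope. A polytope is a bounded intersection of finitely many closed affine half-spaces. *)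

(* Defs.v *)
From mathcomp Require Import all_boot all_order all_algebra.
From mathcomp Require Import all_classical all_reals.
From mathcomp Require Import topology normedtype.
Set Implicit Arguments.
Unset Strict Implicit.
Unset Printing Implicit Defensive.
Import Order.TTheory GRing.Theory Num.Theory.
Import numFieldNormedType.Exports.
Local Open Scope classical_set_scope.
Local Open Scope ring_scope.

Definition closed_half_space (R : realType) (N : nat) (a : 'rV[R]_N) (b : R) :
  set 'rV[R]_N := [set v | \sum_i a ord0 i * v ord0 i <= b].

Definition is_polytope (R : realType) (N : nat) (A : set 'rV[R]_N) : Prop :=
  (exists (k : nat) (a : 'I_k -> 'rV[R]_N) (b : 'I_k -> R),
     (forall i, a i != 0) /\ A = \bigcap_i closed_half_space (a i) (b i))
  /\ bounded_set A.

Record is_probability_function (R : realType) (d : Order.disp_t)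
    (P : finPOrderType d) (pi : P -> P -> R) : Prop := {
  probf_range : forall x y, 0 <= pi x y <= 1;
  probf_refl : forall x, pi x x = 1;
  probf_le : forall x y, (x <= y)%O -> pi x y = 1;
  probf_compl : forall x y, x <> y -> pi x y + pi y x = 1;
  probf_mono : forall x y z, (y < z)%O -> pi x y <= pi x z
}.

Definition probability_functions (R : realType) (d : Order.disp_t)
  (P : finPOrderType d) : set (P -> P -> R) :=
  [set pi | is_probability_function pi].
Arguments probability_functions R {d} P.

Definition coord_vector (R : realType) (T : Type) (N : nat)
  (e : 'I_N -> T * T) (pi : T -> T -> R) : 'rV[R]_N :=
  \row_i pi (e i).1 (e i).2.

(* [e] lists the pairs in [S] without repetition, so necessarily [#|S| = N];
   another choice of [e] only permutes the coordinates of [R^N]. *)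
Definition realised_as_polytope (R : realType) (T : finType) (N : nat)
  (S : {set T * T}) (F : set (T -> T -> R)) : Prop :=
  exists e : 'I_N -> T * T,
    [/\ injective e,
        [set e i | i : 'I_N]%SET = S,
        {in F &, injective (coord_vector e)} &
        is_polytope (coord_vector e @` F)].

Definition distinct_pairs (T : finType) : {set T * T} :=
  [set p | p.1 != p.2]%SET.

Definition incomparable_pairs (d : Order.disp_t) (P : finPOrderType d) :
  {set P * P} := [set p : P * P | (p.1 >< p.2)%O]%SET.

Definition is_antichain (d : Order.disp_t) (P : finPOrderType d)
  (A : {set P}) : bool :=
  [forall x in A, forall y in A, (x != y) ==> (x >< y)%O].

Definition antichains2 (d : Order.disp_t) (P : finPOrderType d) :
  {set {set P}} := [set A : {set P} | (#|A| == 2)%N && is_antichain A]%SET.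

(* Main.v *)
Require Import Defs.
From mathcomp Require Import all_boot all_order all_algebra.
From mathcomp Require Import all_classical all_reals.
From mathcomp Require Import topology normedtype.
From mathcomp Require Import lra.
Import Order.TTheory GRing.Theory Num.Theory.
Import numFieldNormedType.Exports.

(** On comparable pairs every probability function takes the values of the
    indicator of [<=]. Hence it is recovered from its values on any set of pairs
    containing the incomparable ones, and the recovery map, defined on all of
    [R^N], is affine. The image of the set of probability functions is then the
    preimage, under an affine map, of the finitely many linear conditions that
    define probability functions. *)

(** * Finite intersections of half-spaces, and the affine conditions that cut them out *)

Section Polyhedra.
Local Open Scope classical_set_scope.
Local Open Scope ring_scope.
Context {R : realType} {N : nat}.
Set Implicit Arguments.
Implicit Types (A B : set 'rV[R]_N) (f g : 'rV[R]_N -> R).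

(** The unbounded half of [is_polytope]. Without boundedness the class contains the whole space, so
    conditions can be intersected one by one and boundedness checked once at the end. *)
Definition is_polyhedron A : Prop :=
  exists (k : nat) (a : 'I_k -> 'rV[R]_N) (b : 'I_k -> R),
    (forall i, a i != 0) /\ A = \bigcap_i closed_half_space (a i) (b i).

Lemma is_polyhedronT : is_polyhedron setT.
Proof.
exists 0%N, (fun=> 0), (fun=> 0); split; first by case.
by apply/seteqP; split=> // v _ [].
Qed.

Lemma is_polyhedronI A B :
  is_polyhedron A -> is_polyhedron B -> is_polyhedron (A `&` B).
Proof.
move=> [k [a [b [a0 ->]]]] [l [a' [b' [a'0 ->]]]].
exists (k + l)%N, (fun i => match fintype.split i with inl j => a j | inr j => a' j end),
  (fun i => match fintype.split i with inl j => b j | inr j => b' j end).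
split; first by move=> i; case: fintype.split.
apply/seteqP; split=> [v [va vb] i _ | v vab].
  by case: fintype.split => j; [exact: va | exact: vb].
split=> j _.
  by have := vab (unsplit (inl j)) I; rewrite unsplitK.
by have := vab (unsplit (inr j)) I; rewrite unsplitK.
Qed.

Lemma is_polyhedron_forall (T : finType) (F : T -> set 'rV[R]_N) :
  (forall t, is_polyhedron (F t)) -> is_polyhedron [set v | forall t, F t v].
Proof.
move=> polyF.
have -> : [set v | forall t, F t v] = \big[setI/setT]_(t : T) F t.
  rewrite -bigcap_seq; apply/seteqP; split=> v Fv t //=.
  by apply: Fv; rewrite /= mem_index_enum.
by apply: big_ind => *; [exact: is_polyhedronT | exact: is_polyhedronI |].
Qed.

(** [Q] does not depend on [v], so the set is either [A] or the whole space. This serves the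
    conditions guarded by an order relation between fixed elements. *)
Lemma is_polyhedron_imply (Q : Prop) A :
  is_polyhedron A -> is_polyhedron [set v | Q -> A v].
Proof.
move=> polyA; have [q|nq] := pselect Q.
  by have -> : [set v | Q -> A v] = A by apply/seteqP; split=> v /=; [exact | move=> ? _].
have -> : [set v | Q -> A v] = setT by apply/seteqP; split=> // v _ /nq.
exact: is_polyhedronT.
Qed.

Definition affine f : Prop :=
  exists (c : R) (a : 'rV[R]_N), forall v, f v = c + \sum_i a ord0 i * v ord0 i.

Lemma affine_cst c : affine (fun=> c).
Proof.
exists c, 0 => v; rewrite big1 ?addr0// => i _.
by rewrite mxE mul0r.
Qed.

Lemma affine_coord i : affine (fun v => v ord0 i).
Proof.
exists 0, (delta_mx 0 i) => v; rewrite (bigD1 i)//= big1 => [|j ji].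
  by rewrite mxE !eqxx mul1r addr0 add0r.
by rewrite mxE (negbTE ji) andbF mul0r.
Qed.

Lemma affineD f g : affine f -> affine g -> affine (fun v => f v + g v).
Proof.
move=> [c [a fE]] [c' [a' gE]]; exists (c + c'), (a + a') => v.
rewrite fE gE addrACA -big_split/=; congr (_ + _).
by apply: eq_bigr => i _; rewrite mxE mulrDl.
Qed.

Lemma is_polyhedron_half_space (a : 'rV[R]_N) (b : R) :
  a != 0 -> is_polyhedron (closed_half_space a b).
Proof.
move=> a0; exists 1%N, (fun=> a), (fun=> b); split=> //.
by apply/seteqP; split=> [v va i //|v /(_ ord0 I)].
Qed.

Lemma is_polyhedron0 : (0 < N)%N -> is_polyhedron set0.
Proof.
move=> N0; pose i := Ordinal N0; pose a : 'rV[R]_N := delta_mx 0 i.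
have aneq0 : a != 0.
  by apply/eqP => /matrixP/(_ 0 i)/eqP; rewrite !mxE !eqxx oner_eq0.
(* Opposite normals: coordinate [i] would have to be at most -1 and at least 0. *)
have -> : set0 = closed_half_space a (-1) `&` closed_half_space (- a) 0.
  apply/seteqP; split=> // v []; rewrite /closed_half_space/=.
  under [X in _ -> X <= _ -> _]eq_bigr do rewrite mxE mulNr.
  rewrite sumrN; lra.
by apply: is_polyhedronI; apply: is_polyhedron_half_space; rewrite ?oppr_eq0.
Qed.

(* [0 < N] is needed: a constant false inequality has to be written with
   half-spaces of nonzero normal. *)
Lemma is_polyhedron_le f g : (0 < N)%N ->
  affine f -> affine g -> is_polyhedron [set v | f v <= g v].
Proof.
move=> N0 [c [a fE]] [c' [a' gE]].
have -> : [set v | f v <= g v] = closed_half_space (a - a') (c' - c).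
  apply/seteqP; rewrite /closed_half_space; split=> v /=; rewrite fE gE;
  under [X in (X <= c' - c)]eq_bigr do rewrite !mxE mulrBl;
  by rewrite sumrB; lra.
have [->|] := eqVneq (a - a') 0; last exact: is_polyhedron_half_space.
have sum0 v : \sum_i (0 : 'rV[R]_N) ord0 i * v ord0 i = 0.
  by rewrite big1// => i _; rewrite mxE mul0r.
have [b0|b0] := leP 0 (c' - c).
  have -> : closed_half_space (0 : 'rV[R]_N) (c' - c) = setT.
    by apply/seteqP; split=> // v _; rewrite /closed_half_space/= sum0.
  exact: is_polyhedronT.
have -> : closed_half_space (0 : 'rV[R]_N) (c' - c) = set0.
  apply/seteqP; split=> // v; rewrite /closed_half_space/= sum0.
  by rewrite leNgt b0.
exact: is_polyhedron0.
Qed.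

Lemma is_polyhedron_eq f g : (0 < N)%N ->
  affine f -> affine g -> is_polyhedron [set v | f v = g v].
Proof.
move=> N0 af ag.
have -> : [set v | f v = g v] = [set v | f v <= g v] `&` [set v | g v <= f v].
  by apply/seteqP; split=> v /= => [->//|[fg gf]]; apply/le_anti/andP.
by apply: is_polyhedronI; apply: is_polyhedron_le.
Qed.

(** The norm of a row vector is the largest absolute value of its coordinates, so the radius 1
    suffices. *)
Lemma bounded_set_unit_cube A :
  (forall v, A v -> forall i, 0 <= v ord0 i <= 1) -> bounded_set A.
Proof.
move=> A01; exists 1; split; first exact: num_real.
move=> M M1 v /A01 v01; apply: le_trans (ltW M1).
rewrite /Num.norm/= mx_normrE; apply: bigmax_le => // -[i j] _ /=.
rewrite ord1; have /andP[v0 v1] := v01 j.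
by rewrite ger0_norm.
Qed.

End Polyhedra.

(** * Recovering a probability function from its coordinates *)

Section Realisation.
Local Open Scope classical_set_scope.
Local Open Scope ring_scope.
Context {R : realType} {d : Order.disp_t} {P : finPOrderType d}.
Set Implicit Arguments.
Implicit Types pi : P -> P -> R.

(** If [x <= y] fails, then [y <= x] with [y <> x]; so [pi y x] is 1 and the complement rule forces
    [pi x y] to be 0. *)
Lemma probability_comparable pi x y :
  is_probability_function pi -> ~~ (x >< y)%O -> pi x y = (x <= y)%O%:R.
Proof.
move=> ppi; rewrite negbK => xy.
have [xley|nxley] := boolP (x <= y)%O; first exact: probf_le.
move: xy; rewrite /Order.comparable (negbTE nxley)/= => ylex.
have yx : y <> x by move=> yx; rewrite yx lexx in nxley.
have := probf_compl ppi yx; rewrite (probf_le ppi ylex).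
by move=> /= ?; lra.
Qed.

Section Extension.
Context {N : nat} (e : 'I_N -> P * P).

(** The recovery map. A pair not listed by [e] gets the only value that a probability function can
    take there when the pair is comparable. *)
Definition extend (v : 'rV[R]_N) (x y : P) : R :=
  if [pick i | e i == (x, y)] is Some i then v ord0 i else (x <= y)%O%:R.

Lemma coord_vector_extend (v : 'rV[R]_N) :
  injective e -> coord_vector e (extend v) = v.
Proof.
move=> inje; apply/rowP => i; rewrite mxE /extend.
case: pickP => [j /eqP|/(_ i)]; rewrite -surjective_pairing ?eqxx//.
by move=> /inje ->.
Qed.

Lemma extend_coord_vector pi :
  (incomparable_pairs P \subset [set e i | i : 'I_N]%SET) ->
  is_probability_function pi -> extend (coord_vector e pi) = pi.
Proof.
move=> /fintype.subsetP incS ppi; apply/funext => x; apply/funext => y.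
rewrite /extend; case: pickP => [i /eqP exy|exy]; first by rewrite mxE exy.
apply/esym/probability_comparable => //; apply/negP => xy.
have /incS/imsetP[i _ xyE] : (x, y) \in incomparable_pairs P by rewrite inE.
by have := exy i; rewrite -xyE eqxx.
Qed.

(** Whether [(x, y)] is listed does not depend on [v]: the value is a fixed coordinate or a
    constant. *)
Lemma affine_extend x y : affine (fun v => extend v x y).
Proof.
by rewrite /extend; case: pickP => *; [exact: affine_coord | exact: affine_cst].
Qed.

Lemma is_polyhedron_extend : (0 < N)%N ->
  is_polyhedron [set v | is_probability_function (extend v)].
Proof.
move=> N0.
(* The record as a conjunction, with the range condition split into two inequalities, so that each
   conjunct is a finite family of affine conditions. *)
pose conditions v :=
  [/\ forall x y, 0 <= extend v x y /\ extend v x y <= 1,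
      forall x, extend v x x = 1,
      forall x y, (x <= y)%O -> extend v x y = 1,
      forall x y, x <> y -> extend v x y + extend v y x = 1
    & forall x y z, (y < z)%O -> extend v x y <= extend v x z].
have -> : [set v | is_probability_function (extend v)] = [set v | conditions v].
  apply/seteqP; split=> v.
    by case=> h1 h2 h3 h4 h5; split=> // x y; apply/andP.
  by case=> h1 h2 h3 h4 h5; split=> // x y; apply/andP.
have aff := affine_extend.
have affc := @affine_cst R N.
have -> : [set v | conditions v] =
    [set v | forall x y, 0 <= extend v x y /\ extend v x y <= 1] `&`
    ([set v | forall x, extend v x x = 1] `&`
    ([set v | forall x y, (x <= y)%O -> extend v x y = 1] `&`
    ([set v | forall x y, x <> y -> extend v x y + extend v y x = 1] `&`
     [set v | forall x y z, (y < z)%O -> extend v x y <= extend v x z]))).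
  by apply/seteqP; split=> v; [case | case=> ? [? [? []]]].
apply: is_polyhedronI.
  do 2!apply: is_polyhedron_forall => ?.
  by apply: is_polyhedronI; apply: is_polyhedron_le.
apply: is_polyhedronI.
  by apply: is_polyhedron_forall => x; apply: is_polyhedron_eq.
apply: is_polyhedronI.
  do 2!apply: is_polyhedron_forall => ?.
  by apply: is_polyhedron_imply; apply: is_polyhedron_eq.
apply: is_polyhedronI.
  do 2!apply: is_polyhedron_forall => ?.
  by apply: is_polyhedron_imply; apply: is_polyhedron_eq => //; apply: affineD.
do 3!apply: is_polyhedron_forall => ?.
by apply: is_polyhedron_imply; apply: is_polyhedron_le.
Qed.

End Extension.

Lemma realised_probability_functions (S : {set P * P}) (N : nat) :
  (0 < N)%N -> #|S| = N -> incomparable_pairs P \subset S ->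
  realised_as_polytope N S (probability_functions R P).
Proof.
move=> N0 SN incS; pose e (i : 'I_N) := enum_val (cast_ord (esym SN) i).
have inje : injective e by move=> i j /enum_val_inj/cast_ord_inj.
have imE : [set e i | i : 'I_N]%SET = S.
  (* Both sets have [N] elements, so one inclusion is enough. *)
  apply/eqP; rewrite eqEcard card_imset// card_ord SN leqnn andbT.
  by apply/fintype.subsetP => _ /imsetP[i _ ->]; exact: enum_valP.
rewrite -imE in incS.
exists e; split=> //.
  move=> pi pi'; rewrite !inE => ppi ppi' eqpi.
  by rewrite -(extend_coord_vector e incS ppi) eqpi extend_coord_vector.
(* The image becomes a preimage: [extend e] undoes [coord_vector e] on probability functions, and
   [coord_vector e] undoes [extend e] on every vector. *)
have -> : coord_vector e @` probability_functions R P =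
    [set v | is_probability_function (extend e v)].
  apply/seteqP; split=> [_ [pi ppi <-]|v pv].
    by rewrite /= extend_coord_vector.
  by exists (extend e v) => //; exact: coord_vector_extend.
split; first exact: is_polyhedron_extend.
apply: bounded_set_unit_cube => v pv i.
(* Each coordinate of [v] is a value of the probability function [extend e v]. *)
by rewrite -(coord_vector_extend v inje) mxE; exact: probf_range.
Qed.

End Realisation.

(** * Cardinalities of the sets of pairs used as coordinates *)

Section Counting.
Local Open Scope nat_scope.

Lemma card_distinct_pairs (T : finType) :
  #|distinct_pairs T| = #|T| ^ 2 - #|T|.
Proof.
have -> : distinct_pairs T = (~: [set (x, x) | x : T])%SET.
  apply/setP => -[x y]; rewrite !inE/=; congr (~~ _).
  by apply/eqP/imsetP => [->|[z _ [-> ->]]//]; exists y.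
rewrite cardsCs finset.setCK card_prod mulnn card_imset//.
by move=> x y [].
Qed.

Context {d : Order.disp_t} {P : finPOrderType d}.

(** Forgetting the order of a pair maps incomparable pairs to two-element antichains, and every
    fibre has exactly two elements. *)
Lemma card_incomparable_pairs :
  #|incomparable_pairs P| = 2 * #|antichains2 P|.
Proof.
pose f (p : P * P) : {set P} := [set p.1; p.2]%SET.
have neq_inc (x y : P) : (x >< y)%O -> x != y.
  by apply: contraNneq => ->; exact: comparablexx.
have sub_f p : p \in incomparable_pairs P -> f p \in antichains2 P.
  case: p => x y; rewrite !inE/= => xy.
  rewrite cards2 neq_inc//=; apply/forall_inP => u; rewrite !inE => ux.
  apply/forall_inP => v; rewrite !inE => vx; apply/implyP.
  case/orP: ux => /eqP ->; case/orP: vx => /eqP ->; rewrite ?eqxx//.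
  by rewrite comparable_sym.
rewrite -sum1_card (partition_big f (mem (antichains2 P)))//=.
rewrite mulnC -sum_nat_const; apply: eq_bigr => B.
rewrite inE => /andP[/cards2P[x [y [xy ->]]] /forall_inP anti].
have xinc : (x >< y)%O.
  have /anti/forall_inP/(_ y) : x \in [set x; y]%SET by rewrite !inE eqxx.
  by rewrite !inE eqxx orbT xy; exact.
rewrite sum1dep_card.
have -> : [set p in incomparable_pairs P | f p == [set x; y]%SET]%SET =
    [set (x, y); (y, x)]%SET.
  apply/setP => -[u v]; rewrite !inE/= !xpair_eqE.
  apply/andP/orP => [[uv /eqP/setP fE]|[|] /andP[/eqP-> /eqP->]].
  - have := fE u; have := fE v; rewrite /f !inE/= !eqxx orbT/=.
    (* Each of [u] and [v] is [x] or [y]; the cases with [u = v] contradict incomparability. *)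
    have := neq_inc _ _ uv => {uv} uv /esym/orP[] /eqP vE /esym/orP[] /eqP uE;
    subst u v; rewrite ?eqxx// in uv *; by [left | right].
  - by rewrite xinc eqxx.
  - by rewrite comparable_sym xinc /f/= finset.setUC eqxx.
by rewrite cards2 xpair_eqE (negbTE xy).
Qed.

Lemma incomparable_pairs_gt0 :
  ~ total (<=%O : rel P) -> 0 < #|incomparable_pairs P|.
Proof.
move=> ntot; rewrite card_gt0; apply: contra_notN ntot => /eqP inc0 x y.
have : (x, y) \notin incomparable_pairs P by rewrite inc0 inE.
by rewrite inE negbK.
Qed.

Lemma incomparable_sub_distinct : incomparable_pairs P \subset distinct_pairs P.
Proof.
apply/fintype.subsetP => -[x y]; rewrite !inE/=.
by apply: contraNneq => ->; exact: comparablexx.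
Qed.

End Counting.

(** * The three choices of coordinates: all pairs, distinct pairs, incomparable pairs *)

Theorem theorem4p1 (R : realType) (d : Order.disp_t) (P : finPOrderType d)
    (n m : nat) (hn : #|P| = n) (hm : #|antichains2 P| = m)
    (hP : ~ total (<=%O : rel P)) :
  [/\ (0 < m)%N,
      #|incomparable_pairs P| = (2 * m)%N,
      realised_as_polytope (n ^ 2) [set: P * P]%SET
        (probability_functions R P),
      realised_as_polytope (n ^ 2 - n) (distinct_pairs P)
        (probability_functions R P) &
      realised_as_polytope (2 * m) (incomparable_pairs P)
        (probability_functions R P)].
Proof.
have inc2m : #|incomparable_pairs P| = (2 * m)%N.
  by rewrite card_incomparable_pairs hm.
have inc_gt0 := incomparable_pairs_gt0 hP.
have realised (S : {set P * P}) N : #|S| = N -> incomparable_pairs P \subset S ->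
    realised_as_polytope N S (probability_functions R P).
  move=> SN incS; apply: realised_probability_functions => //.
  (* The dimension is positive because [S] contains an incomparable pair, which exists since [P] is
     not a chain. *)
  by rewrite -SN; exact: leq_trans inc_gt0 (subset_leq_card incS).
split=> //.
- by move: inc_gt0; rewrite inc2m muln_gt0.
- by apply: realised; rewrite ?subsetT// cardsT card_prod hn mulnn.
- apply: realised; first by rewrite card_distinct_pairs hn.
  exact: incomparable_sub_distinct.
- exact: realised.
Qed.
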